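(* Let $n\ge2$, $x\in\mathbb{B}^n$ and $t>0$. Then $$B_\rho(x,r)\subset B_c(x,t)\subset B_\rho(x,R),$$ where $$r=\log\left(1+\frac{2t(1-|x|)}{(1+|x|)(1+t(1-|x|))}\right)$$ and $R=\min\{R_1,R_2\}$ with $$R_1=2\,\mathrm{arsinh}\left(\frac{\exp\left(\frac{t(1-|x|)}{1-t(1-|x|)}\right)-1}{1+|x|}\right),\qquad R_2=\log\left(1+\frac{2\left(\exp\left(\frac{t(1-|x|)}{1-t(1-|x|)}\right)-1\right)}{1-|x|}\right).$$
   Context: $\mathbb{B}^n=\{x\in\mathbb{R}^n:|x|<1\}$ with $|\cdot|$ the Euclidean norm; $\mathrm{arsinh}$ is the inverse hyperbolic sine. The Cassinian metric of $\mathbb{B}^n$ is $$c_{\mathbb{B}^n}(x,y)=\sup_{p\in\partial\mathbb{B}^n}\frac{|x-y|}{|x-p||p-y|}.$$ The hyperbolic metric of $\mathbb{B}^n$ is $$\rho_{\mathbb{B}^n}(x,y)=\inf_{\gamma}\int_\gamma\frac{2|dz|}{1-|z|^2},$$ the infimum being over all rectifiable curves $\gamma$ in $\mathbb{B}^n$ joining $x$ and $y$. The balls are $B_c(x,t)=\{y\in\mathbb{B}^n:c_{\mathbb{B}^n}(x,y)<t\}$ and $B_\rho(x,r)=\{y\in\mathbb{B}^n:\rho_{\mathbb{B}^n}(x,y)<r\}$.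
   Formalization: The second inclusion is stated only for t(1-|x|) < 1; for t(1-|x|) = 1 the formula for R divides by zero, and for t(1-|x|) > 1 one has R < 0, so B_ρ(x,R) is empty while x lies in B_c(x,t). *)

(* Defs.v *)
From mathcomp Require Import all_boot all_order all_algebra.
From mathcomp Require Import all_classical all_reals all_analysis.
From mathcomp Require Import ring lra.

Set Implicit Arguments.
Unset Strict Implicit.
Unset Printing Implicit Defensive.

Import Order.TTheory GRing.Theory Num.Theory.
Import numFieldNormedType.Exports.

Local Open Scope classical_set_scope.
Local Open Scope ring_scope.

Section Defs.
Context {R : realType}.
Implicit Types (n : nat) (a b r t : R).

(* [enorm] is needed because the library norm on ['rV[R]_n] is the sup norm.
   Both induce the same topology, so [closure], [interior] and continuity below
   are the Euclidean ones. *)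
Definition enorm n (x : 'rV[R]_n) : R := Num.sqrt (\sum_(i < n) x 0 i ^+ 2).

Definition unit_ball {n} : set 'rV[R]_n := [set x | enorm x < 1].

Definition boundary n (D : set 'rV[R]_n) : set 'rV[R]_n :=
  closure D `\` interior D.

(* For [0 < n] and [x, y] in a bounded open [D] the set is nonempty and bounded above, so
   that [sup] is the genuine supremum. *)
Definition cassinian n (D : set 'rV[R]_n) (x y : 'rV[R]_n) : R :=
  sup [set enorm (x - y) / (enorm (x - p) * enorm (p - y)) | p in boundary D].

Definition cassinian_ball n (x : 'rV[R]_n) t : set 'rV[R]_n :=
  [set y | unit_ball y /\ cassinian unit_ball x y < t].

(* When [itv_partition a b s], the points of the partition are
   [knot a s 0 = a < knot a s 1 < ... < knot a s (size s) = b]. *)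
Definition knot a (s : seq R) (i : nat) : R := nth a (a :: s) i.

Definition rectifiable n a b (g : R -> 'rV[R]_n) : Prop :=
  exists L : R, forall s, itv_partition a b s ->
    \sum_(0 <= i < size s) enorm (g (knot a s i.+1) - g (knot a s i)) <= L.

(* [I] is the integral of [f] with respect to arc length along [g] on [a, b],
   as the limit of the Riemann sums
   f(g(xi_i)) |g(t_{i+1}) - g(t_i)|, t_i <= xi_i <= t_{i+1}, when the mesh of
   the partition tends to 0. This limit exists whenever [g] is continuous and
   rectifiable and [f] is continuous along [g]; it does not depend on the
   parametrization. *)
Definition is_line_integral n (f : 'rV[R]_n -> R) a b (g : R -> 'rV[R]_n)
    (I : R) : Prop :=
  forall e : R, 0 < e -> exists2 d : R, 0 < d &
    forall (s : seq R) (xi : nat -> R), itv_partition a b s ->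
      (forall i, (i < size s)%N ->
         [/\ knot a s i.+1 - knot a s i < d,
             knot a s i <= xi i & xi i <= knot a s i.+1]) ->
      `| \sum_(0 <= i < size s)
           f (g (xi i)) * enorm (g (knot a s i.+1) - g (knot a s i)) - I | < e.

Definition rectifiable_curve n (D : set 'rV[R]_n) (x y : 'rV[R]_n) a b
    (g : R -> 'rV[R]_n) : Prop :=
  [/\ a <= b, {within `[a, b], continuous g}, rectifiable a b g,
      (forall t, a <= t <= b -> D (g t)) & g a = x /\ g b = y].

Definition hyperbolic_density n (z : 'rV[R]_n) : R := 2 / (1 - enorm z ^+ 2).

Definition hyperbolic n (x y : 'rV[R]_n) : R :=
  inf [set I | exists a b g, rectifiable_curve unit_ball x y a b g /\
                             is_line_integral (@hyperbolic_density n) a b g I].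

Definition hyperbolic_ball n (x : 'rV[R]_n) r : set 'rV[R]_n :=
  [set y | unit_ball y /\ hyperbolic x y < r].

Definition sinh (u : R) : R := (expR u - expR (- u)) / 2.

Definition arsinh (u : R) : R := ln (u + Num.sqrt (u ^+ 2 + 1)).

Lemma arsinhK : cancel arsinh sinh.
Proof.
move=> u; rewrite /sinh /arsinh; set w := Num.sqrt _.
have w2 : w ^+ 2 = u ^+ 2 + 1 by rewrite sqr_sqrtr // addr_ge0 ?sqr_ge0.
have w0 : 0 <= w by exact: sqrtr_ge0.
have p : 0 < u + w.
  have [u0|u0] := leP 0 u.
    have : w != 0 by apply: contra_eq_neq w2 => ->; rewrite expr0n /=; nra.
    by lra.
  by rewrite ltNge; apply/negP => h; nra.
rewrite expRN lnK ?posrE //.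
have -> : (u + w)^-1 = w - u.
  apply: (mulfI (lt0r_neq0 p)); rewrite mulfV ?lt0r_neq0 //.
  have -> : (u + w) * (w - u) = w ^+ 2 - u ^+ 2 by ring.
  by rewrite w2 addrC addKr.
by lra.
Qed.

Lemma sinhK : cancel sinh arsinh.
Proof.
move=> u; rewrite /sinh /arsinh.
have h : expR u * expR (- u) = 1 by rewrite -expRD subrr expR0.
have -> : ((expR u - expR (- u)) / 2) ^+ 2 + 1
          = ((expR u + expR (- u)) / 2) ^+ 2.
  by rewrite -[X in _ + X]h; field.
rewrite sqrtr_sqr ger0_norm ?divr_ge0 ?addr_ge0 ?expR_ge0 //.
have -> : (expR u - expR (- u)) / 2 + (expR u + expR (- u)) / 2 = expR u.
  by lra.
exact: expRK.
Qed.

End Defs.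

(* Main.v *)
Require Import Defs.
From mathcomp Require Import all_boot all_order all_algebra.
From mathcomp Require Import all_classical all_reals all_analysis.
From mathcomp Require Import ring lra.

Set Implicit Arguments.
Unset Strict Implicit.
Unset Printing Implicit Defensive.

Import Order.TTheory GRing.Theory Num.Theory.
Import numFieldNormedType.Exports.

Local Open Scope classical_set_scope.
Local Open Scope ring_scope.

(** Write [m = |x|], [s = |y|], [d = |x - y|], [M = max m s], and
    [q = t (1 - m) / (1 - t (1 - m))], so that [E = e^q]. The exact formula for
    the hyperbolic distance is avoided; three elementary estimates suffice.

    Lower bound for [rho] ([hyperbolic_ge]):
    [rho >= ln (1 + 2 d / (1 - m^2))]. The slope of
    [ln (1 - m^2 + 2 |z - x|)] in [z] is at most the density [2 / (1 - |z|^2)],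
    because [m^2 - |z|^2 <= 2 (m - |z|)^+ <= 2 |z - x|]. Now [rho < r] gives
    [d < t (1 - m)^2 / (1 + t (1 - m))], hence [d < 1 - m]; a boundary point [p]
    has [|x - p| >= 1 - m] and [|p - y| >= 1 - m - d], so that
    [c <= d / ((1 - m) (1 - m - d)) < t] ([cassinian_le]).

    Upper bounds for [rho] come from the Euclidean segment, on which
    [|z| <= M]. Bounding the density by its maximum gives
    [rho <= 2 d / (1 - M^2)] ([hyperbolic_le_density]). Splitting it as
    [1 / (1 - |z|) + 1 / (1 + |z|)] and using [|z| >= |z - x| - m] in the second
    term gives [rho <= d / (1 - M) + ln (1 + d / (1 - m))]
    ([hyperbolic_le_split]).

    For the second inclusion, the boundary points nearest to [x] and to [y] in
    the supremum defining [c] show that [c < t] implies [d < q (1 - M)]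
    ([cassinian_ge_nearest], [cassinian_lt_dist]). The first upper bound becomes
    [rho < 2 q / (1 + m) <= R1], by [k sinh (q / k) <= e^q - 1] for [k >= 1]
    ([le_arsinh]); the second becomes
    [rho < q + ln (1 + d / (1 - m)) <= R2], by [e^q >= 1 + q]
    ([expR_split_le]).

    Both kinds of bounds on line integrals are read off from Riemann sums: with
    the tags at the appropriate ends, every term compares with an increment of
    one function of the parameter, and the sum telescopes. *)

(** * Euclidean norm and the boundary of the ball *)

Section EuclideanNorm.
Context {R : realType} {n : nat}.
Implicit Types (x y z : 'rV[R]_n).

Definition dotp x y : R := \sum_(i < n) x 0 i * y 0 i.

Lemma enorm_ge0 x : 0 <= enorm x.
Proof. exact: sqrtr_ge0. Qed.

Lemma enorm_sqr x : enorm x ^+ 2 = dotp x x.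
Proof.
rewrite sqr_sqrtr; last by apply: sumr_ge0 => i _; exact: sqr_ge0.
by apply: eq_bigr => i _; rewrite expr2.
Qed.

Lemma enorm_comb (a b : R) x y :
  enorm (a *: x + b *: y) ^+ 2
  = a ^+ 2 * enorm x ^+ 2 + 2 * a * b * dotp x y + b ^+ 2 * enorm y ^+ 2.
Proof.
rewrite !enorm_sqr /dotp !mulr_sumr -!big_split /=.
by apply: eq_bigr => i _; rewrite !mxE; ring.
Qed.

(** Nonnegativity of [| |y| x - |x| y |^2 = 2 |x| |y| (|x| |y| - x.y)]. *)
Lemma dotp_le x y : dotp x y <= enorm x * enorm y.
Proof.
have [|xy] := boolP (enorm x * enorm y == 0); last first.
  have p : 0 < enorm x * enorm y by rewrite lt0r xy mulr_ge0 ?enorm_ge0.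
  have := sqr_ge0 (enorm (enorm y *: x + (- enorm x) *: y)).
  rewrite enorm_comb => h; rewrite -subr_ge0 -(pmulr_rge0 _ p); nra.
have null (u : 'rV[R]_n) : enorm u == 0 -> forall i, u 0 i = 0.
  move=> /eqP u0 i; have := enorm_sqr u; rewrite u0 expr0n /= => /esym/eqP.
  rewrite psumr_eq0 => [/allP/(_ i)|j _]; last by rewrite -expr2 sqr_ge0.
  by rewrite mem_index_enum => /(_ isT); rewrite /= -expr2 sqrf_eq0 => /eqP.
rewrite mulf_eq0 => xy; rewrite /dotp big1 ?mulr_ge0 ?enorm_ge0 // => i _.
by case/orP: xy => /null ->; rewrite ?mul0r ?mulr0.
Qed.

Lemma enormZ (a : R) x : enorm (a *: x) = `|a| * enorm x.
Proof.
apply: (@pexpIrn _ 2) => //; rewrite ?nnegrE ?mulr_ge0 ?enorm_ge0 //.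
have := enorm_comb a 0 x 0; rewrite scaler0 addr0 => ->.
by rewrite exprMn real_normK ?num_real //; ring.
Qed.

Lemma enorm0 : enorm (0 : 'rV[R]_n) = 0.
Proof. by rewrite -(scale0r (0 : 'rV[R]_n)) enormZ normr0 mul0r. Qed.

Lemma enormN x : enorm (- x) = enorm x.
Proof. by rewrite -scaleN1r enormZ normrN1 mul1r. Qed.

Lemma enorm_distC x y : enorm (x - y) = enorm (y - x).
Proof. by rewrite -enormN opprB. Qed.

Lemma enormD x y : enorm (x + y) <= enorm x + enorm y.
Proof.
rewrite -(@ler_pXn2r _ 2) ?nnegrE ?addr_ge0 ?enorm_ge0 //.
have := enorm_comb 1 1 x y; rewrite !scale1r => ->.
have := dotp_le x y; nra.
Qed.

Lemma enorm_dist_triangle z x y : enorm (x - y) <= enorm (x - z) + enorm (z - y).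
Proof. by rewrite -[x - y](subrKA z); apply: enormD. Qed.

Lemma enorm_sub_ge x y : enorm x - enorm y <= enorm (x - y).
Proof. by rewrite lerBlDr -{1}[x](subrK y); apply: enormD. Qed.

Lemma enorm_continuous : continuous (@enorm R n).
Proof.
move=> x; apply: (@continuous_comp _ _ _
  (fun x : 'rV[R]_n => \sum_(i < n) x 0 i ^+ 2) Num.sqrt);
  last exact: sqrt_continuous.
apply: (@continuous_big _ _ +%R) => [|i _ {}x]; first exact: add_continuous.
apply: (@continuous_comp _ _ _ (fun x : 'rV[R]_n => x 0 i) (fun a : R => a ^+ 2)).
  exact: coord_continuous.
exact: exprn_continuous.
Qed.

Lemma boundary_unit_ball_ge (p : 'rV[R]_n) :
  boundary unit_ball p -> 1 <= enorm p.
Proof.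
move=> [_ pi]; rewrite leNgt; apply/negP => p1; apply: pi.
have /(@enorm_continuous p) : nbhs (enorm p) [set a : R | a < 1] by exact: lt_nbhsl.
exact.
Qed.

(** Points just below [p] on its ray lie in the ball, points just above do not. *)
Lemma boundary_unit_ball_sphere (p : 'rV[R]_n) :
  enorm p = 1 -> boundary unit_ball p.
Proof.
move=> p1.
have cp : (a *: p) @[a --> (1 : R)] --> p.
  by rewrite -[X in _ --> X]scale1r; apply: cvgZr_tmp; exact: cvg_id.
split=> [B Bp|pi].
  have := cvg_at_left_filter cp Bp => Bl.
  near (1 : R)^'- => a; exists (a *: p); split; last by near: a.
  have a0 : 0 < a by near: a; exact: nbhs_left_gt.
  have a1 : a < 1 by near: a; exact: nbhs_left_lt.
  by rewrite /unit_ball /= enormZ p1 mulr1 gtr0_norm.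
have Br := cvg_at_right_filter cp pi.
near (1 : R)^'+ => a.
have a1 : 1 < a by near: a; exact: nbhs_right_gt.
have : unit_ball (a *: p) by near: a.
by rewrite /unit_ball /= enormZ p1 mulr1 ltNge ler_normr (ltW a1).
Unshelve. all: by end_near. Qed.

End EuclideanNorm.

(** The boundary point nearest to [x] is the radial projection of [x]; at
    the centre any unit vector will do. *)
Lemma nearest_boundary_point (R : realType) n (x : 'rV[R]_n) :
    (0 < n)%N -> enorm x < 1 ->
  exists2 p, enorm p = 1 & enorm (x - p) = 1 - enorm x.
Proof.
case: n x => // k x _ x1; have [x0|x0] := eqVneq (enorm x) 0; last first.
  exists ((enorm x)^-1 *: x).
    by rewrite enormZ gtr0_norm ?mulVf // invr_gt0 lt0r x0 enorm_ge0.
  have xp : 0 < enorm x by rewrite lt0r x0 enorm_ge0.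
  have -> : x - (enorm x)^-1 *: x = (1 - (enorm x)^-1) *: x.
    by rewrite scalerBl scale1r.
  rewrite enormZ ler0_norm; first by field.
  by rewrite subr_le0 invf_ge1 // ltW.
have p1 : enorm (delta_mx 0 0 : 'rV[R]_k.+1) = 1.
  apply: (@pexpIrn _ 2) => //; rewrite ?nnegrE ?enorm_ge0 // enorm_sqr /dotp.
  rewrite big_ord_recl big1 => [|i _]; rewrite !mxE /= ?mulr0 //.
  by rewrite mulr1 addr0 expr1n.
exists (delta_mx 0 0) => //; apply/eqP; rewrite x0 subr0 eq_le; apply/andP; split.
  by have := enormD x (- delta_mx 0 0); rewrite enormN p1 x0 add0r.
by have := enorm_sub_ge (delta_mx 0 0) x; rewrite p1 x0 subr0 enorm_distC.
Qed.

(** * Partitions and line integrals *)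

Section Partitions.
Context {R : realType}.
Implicit Types (a b : R) (s : seq R) (i : nat).

Lemma knot_size a b s : itv_partition a b s -> knot a s (size s) = b.
Proof. by case=> _ /eqP <-; rewrite /knot -last_nth. Qed.

Lemma knot_lt a b s i : itv_partition a b s -> (i < size s)%N ->
  knot a s i < knot a s i.+1.
Proof. by case=> /(pathP a) h _ /h. Qed.

Lemma knot_itv a b s i : itv_partition a b s -> (i <= size s)%N ->
  a <= knot a s i <= b.
Proof.
move=> abs si; rewrite /knot (set_nth_default b) //.
by rewrite itv_partition_nth_ge ?itv_partition_nth_le.
Qed.

Lemma sum_knots a b s (G : R -> R) : itv_partition a b s ->
  \sum_(0 <= i < size s) (G (knot a s i.+1) - G (knot a s i)) = G b - G a.
Proof.
by move=> abs; rewrite (@telescope_sumr _ _ _ (G \o knot a s)) //= (knot_size abs).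
Qed.

Lemma fine_partition a b (d : R) : a <= b -> 0 < d ->
  exists2 s, itv_partition a b s &
    forall i, (i < size s)%N -> knot a s i.+1 - knot a s i < d.
Proof.
rewrite le_eqVlt => /predU1P[<- _|ab d0].
  by exists [::] => //; split => //=.
have ba0 : 0 < b - a by rewrite subr_gt0.
have := archi_boundP (divr_ge0 (ltW ba0) (ltW d0)); set N := Num.bound _ => hN.
have N0 : 0 < N%:R :> R by rewrite (le_lt_trans _ hN) // divr_ge0 // ltW.
pose p i := a + (b - a) * i%:R / N%:R.
have kp i : (i <= N)%N -> nth a (a :: mkseq (p \o S) N) i = p i.
  case: i => [|i] iN; first by rewrite /p mulr0 mul0r addr0.
  by rewrite /= nth_mkseq.
have pS i : p i.+1 - p i = (b - a) / N%:R.
  by rewrite /p -natr1; field; rewrite lt0r_neq0.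
exists (mkseq (p \o S) N).
  split.
    apply/(pathP a) => i; rewrite size_mkseq => iN.
    rewrite kp ?(ltnW iN) // nth_mkseq //= -subr_gt0 pS.
    by rewrite divr_gt0.
  rewrite (last_nth a) size_mkseq kp // /p mulfK ?lt0r_neq0 //.
  by rewrite addrCA subrr addr0.
move=> i; rewrite size_mkseq => iN; rewrite /knot !kp // ?(ltnW iN) // pS.
by rewrite ltr_pdivrMr // mulrC -ltr_pdivrMr.
Qed.

End Partitions.

Section LineIntegral.
Context {R : realType} {n : nat}.
Implicit Types (a b I : R) (f : 'rV[R]_n -> R) (g : R -> 'rV[R]_n).

Lemma line_integral_approx f a b g I (tag : R -> R -> R) :
    a <= b -> (forall u w, u <= w -> u <= tag u w <= w) ->
    is_line_integral f a b g I -> forall e, 0 < e ->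
  exists2 s, itv_partition a b s &
    `| \sum_(0 <= i < size s) f (g (tag (knot a s i) (knot a s i.+1))) *
         enorm (g (knot a s i.+1) - g (knot a s i)) - I | < e.
Proof.
move=> ab tagP fI e e0; have [d d0 sd] := fI e e0.
have [s abs sP] := fine_partition ab d0; exists s => //.
apply: (sd s (fun i => tag (knot a s i) (knot a s i.+1))) => // i si.
by have /andP[] := tagP _ _ (ltW (knot_lt abs si)); split => //; exact: sP.
Qed.

(** A bound of every term of the tagged sums by an increment of [G] telescopes;
    since the tags may be chosen freely, no mesh-dependent error survives. *)
Lemma line_integral_le f a b g I (G : R -> R) (tag : R -> R -> R) :
    a <= b -> (forall u w, u <= w -> u <= tag u w <= w) ->
    (forall u w, a <= u -> u < w -> w <= b ->
       f (g (tag u w)) * enorm (g w - g u) <= G w - G u) ->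
  is_line_integral f a b g I -> I <= G b - G a.
Proof.
move=> ab tagP fG fI; apply/ler_addgt0Pr => e e0.
have [s abs] := line_integral_approx ab tagP fI e0.
rewrite distrC ltr_distl => /andP[_ /ltW/le_trans]; apply.
rewrite lerD2r -(sum_knots G abs) !big_mkord; apply: ler_sum => i _.
have /andP[ai _] := knot_itv abs (ltnW (ltn_ord i)).
have /andP[_ ib] := knot_itv abs (ltn_ord i).
by apply: fG => //; exact: knot_lt abs _.
Qed.

Lemma line_integral_ge f a b g I (G : R -> R) (tag : R -> R -> R) :
    a <= b -> (forall u w, u <= w -> u <= tag u w <= w) ->
    (forall u w, a <= u -> u < w -> w <= b ->
       G w - G u <= f (g (tag u w)) * enorm (g w - g u)) ->
  is_line_integral f a b g I -> G b - G a <= I.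
Proof.
move=> ab tagP fG fI.
have: is_line_integral (fun z => - f z) a b g (- I).
  move=> e /fI[d d0 sd]; exists d => // s xi /sd/[apply] h.
  by under eq_bigr do rewrite mulNr; rewrite sumrN -opprD normrN.
move=> /(line_integral_le (G := fun z => - G z) ab tagP).
rewrite lerNl opprB opprK addrC; apply => u w au uw wb.
by rewrite mulNr -opprD lerN2 fG.
Qed.

(** The errors add up to at most [K (b - a)] times the mesh. *)
Lemma is_line_integral_primitive f a b g (H : R -> R) (K : R) :
    a <= b -> 0 <= K ->
    (forall u xi w, a <= u -> u <= xi -> xi <= w -> w <= b ->
       `|f (g xi) * enorm (g w - g u) - (H w - H u)| <= K * (w - u) ^+ 2) ->
  is_line_integral f a b g (H b - H a).
Proof.
move=> ab K0 fH e e0; have c0 : 0 < K * (b - a) + 1.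
  by rewrite ltr_wpDl // mulr_ge0 // subr_ge0.
exists (e / (K * (b - a) + 1)) => [|s xi abs xiP]; first by rewrite divr_gt0.
rewrite -(sum_knots H abs) -sumrB.
apply: (le_lt_trans (ler_norm_sum _ _ _)).
(* the mesh replaces one of the two factors of [(w - u) ^+ 2] *)
pose c := K * (e / (K * (b - a) + 1)).
apply: (@le_lt_trans _ _
    (\sum_(0 <= i < size s) (c * knot a s i.+1 - c * knot a s i))).
  rewrite !big_mkord; apply: ler_sum => i _.
  have /andP[ai _] := knot_itv abs (ltnW (ltn_ord i)).
  have /andP[_ ib] := knot_itv abs (ltn_ord i).
  have [md lxi xir] := xiP i (ltn_ord i).
  apply: (le_trans (fH _ _ _ ai lxi xir ib)).
  have k0 : 0 <= knot a s i.+1 - knot a s i by rewrite subr_ge0 (le_trans lxi).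
  by rewrite -mulrBr /c -mulrA ler_wpM2l // expr2 ler_wpM2r // ltW.
rewrite (sum_knots ( *%R c) abs) -mulrBr /c.
rewrite -subr_gt0 (_ : _ - _ = e / (K * (b - a) + 1)); first by rewrite divr_gt0.
by field; rewrite lt0r_neq0.
Qed.

End LineIntegral.

(** * Hyperbolic length from below *)

Section LogarithmEstimates.
Context {R : realType}.
Implicit Types a u v w xi : R.

(** The graph of [ln] lies below its tangent at [u]. *)
Lemma ln_sub_le u v : 0 < u -> 0 < v -> ln v - ln u <= (v - u) / u.
Proof.
move=> u0 v0; rewrite -ln_div ?posrE //.
have -> : v / u = 1 + (v - u) / u by field; rewrite lt0r_neq0.
by apply: le_ln1Dx; rewrite ltr_pdivlMr // mulN1r ltrBrDr addNr.
Qed.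

(** Both terms on the left lie between [(w - u) / w] and [(w - u) / u]. *)
Lemma ln_sub_approx a u xi w : 0 < a -> a <= u -> u <= xi -> xi <= w ->
  `|(w - u) / xi - (ln w - ln u)| <= (w - u) ^+ 2 / a ^+ 2.
Proof.
move=> a0 au uxi xiw.
have u0 := lt_le_trans a0 au; have xi0 := lt_le_trans u0 uxi.
have w0 := lt_le_trans xi0 xiw; have aw := le_trans au (le_trans uxi xiw).
have wu0 : 0 <= w - u by rewrite subr_ge0 (le_trans uxi).
have hu := ln_sub_le u0 w0; have hw := ln_sub_le w0 u0.
have xu : (w - u) / xi <= (w - u) / u by rewrite ler_wpM2l // lef_pV2.
have xw : (w - u) / w <= (w - u) / xi by rewrite ler_wpM2l // lef_pV2.
have hw' : (u - w) / w = - ((w - u) / w) by rewrite -mulNr opprB.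
have gap : (w - u) / u - (w - u) / w <= (w - u) ^+ 2 / a ^+ 2.
  have -> : (w - u) / u - (w - u) / w = (w - u) ^+ 2 / (u * w).
    by field; rewrite !lt0r_neq0.
  rewrite ler_wpM2l ?sqr_ge0 // lef_pV2 ?posrE ?exprn_gt0 ?mulr_gt0 //.
  by rewrite expr2 ler_pM // ltW.
rewrite ler_norml; apply/andP; split; lra.
Qed.

End LogarithmEstimates.

(** The denominators compare by
    [|x|^2 - |z|^2 = (|x| - |z|) (|x| + |z|)] and [|x| + |z| <= 2]. *)
Lemma hyperbolic_density_ge (R : realType) n (x z : 'rV[R]_n) :
    enorm x < 1 -> enorm z < 1 ->
  2 / (1 - enorm x ^+ 2 + 2 * enorm (z - x)) <= hyperbolic_density z.
Proof.
move=> x1 z1; have := enorm_sub_ge x z; rewrite enorm_distC.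
have := enorm_ge0 x; have := enorm_ge0 z; have := enorm_ge0 (z - x) => d0 z0 x0 d.
rewrite /hyperbolic_density ler_wpM2l // lef_pV2 ?posrE; nra.
Qed.

(** The function [ln (1 - |x|^2 + 2 |z - x|)] of [z] has slope at most the
    hyperbolic density, and it is concave in [|z - x|], so tagging each piece
    at its left end bounds its increments by the Riemann sums. *)
Lemma hyperbolic_length_ge (R : realType) n (x y : 'rV[R]_n) a b g I :
    rectifiable_curve unit_ball x y a b g ->
    is_line_integral (@hyperbolic_density R n) a b g I ->
  ln (1 + 2 * enorm (x - y) / (1 - enorm x ^+ 2)) <= I.
Proof.
move=> [ab _ _ gB [ga gb]].
have x1 : enorm x < 1 by have := gB a; rewrite lexx ab ga; apply.
have A0 : 0 < 1 - enorm x ^+ 2 by have := enorm_ge0 x; nra.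
have p z : 0 < 1 - enorm x ^+ 2 + 2 * enorm (z - x) :> R.
  by rewrite ltr_wpDr // mulr_ge0 ?enorm_ge0.
pose G l : R := ln (1 - enorm x ^+ 2 + 2 * enorm (g l - x)).
have -> : ln (1 + 2 * enorm (x - y) / (1 - enorm x ^+ 2)) = G b - G a.
  rewrite /G ga gb -ln_div ?posrE ?p //.
  rewrite subrr enorm0 mulr0 addr0 enorm_distC; congr ln.
  by field; rewrite lt0r_neq0.
apply: (line_integral_ge (tag := fun u _ => u) ab) => [u w uw|u w au uw wb].
  by rewrite lexx.
have gu1 : enorm (g u) < 1 by apply: gB; rewrite au (le_trans (ltW uw)).
apply: (le_trans (ln_sub_le (p _) (p _))).
apply: (@le_trans _ _ (2 / (1 - enorm x ^+ 2 + 2 * enorm (g u - x)) *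
                       enorm (g w - g u))).
  rewrite mulrAC ler_wpM2r ?invr_ge0 ?(ltW (p _)) //.
  by have := enorm_dist_triangle (g u) (g w) x; lra.
by rewrite ler_wpM2r ?enorm_ge0 // hyperbolic_density_ge.
Qed.

(** * Hyperbolic length of segments *)

Section Segment.
Context {R : realType} {n : nat}.
Implicit Types (x y : 'rV[R]_n).

Definition segment x y (l : R) : 'rV[R]_n := x + l *: (y - x).

Lemma segment_sub x y u w : u <= w ->
  enorm (segment x y w - segment x y u) = enorm (x - y) * (w - u).
Proof.
move=> uw; have -> : segment x y w - segment x y u = (w - u) *: (y - x).
  by rewrite /segment opprD addrACA subrr add0r -scalerBl.
by rewrite enormZ ger0_norm ?subr_ge0 // mulrC enorm_distC.
Qed.

Lemma enorm_segment_le x y l (M : R) : 0 <= l <= 1 ->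
  enorm x <= M -> enorm y <= M -> enorm (segment x y l) <= M.
Proof.
move=> /andP[l0 l1] xM yM.
have -> : segment x y l = (1 - l) *: x + l *: y.
  by rewrite /segment scalerBr scalerBl scale1r addrA addrAC.
apply: (le_trans (enormD _ _)).
by rewrite !enormZ !ger0_norm ?subr_ge0 //; nra.
Qed.

Lemma segment_unit_ball x y l : unit_ball x -> unit_ball y -> 0 <= l <= 1 ->
  enorm (segment x y l) < 1.
Proof.
move=> x1 y1 l01.
apply: (@le_lt_trans _ _ (Num.max (enorm x) (enorm y))); last by rewrite gt_max x1.
by apply: enorm_segment_le; rewrite // le_max lexx ?orbT.
Qed.

Lemma segment_rectifiable_curve x y : unit_ball x -> unit_ball y ->
  rectifiable_curve unit_ball x y 0 1 (segment x y).
Proof.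
move=> x1 y1; split => //.
- apply: continuous_subspaceT => l; apply: cvgD; first exact: cvg_cst.
  by apply: cvgZr_tmp; exact: cvg_id.
- exists (enorm (x - y)) => s s01.
  have := sum_knots ( *%R (enorm (x - y))) s01.
  rewrite mulr1 mulr0 subr0 => <-; rewrite !big_mkord ler_sum // => i _.
  by rewrite segment_sub ?mulrBr // ltW // (knot_lt s01).
- by move=> l l01; exact: segment_unit_ball.
- by rewrite /segment scale0r scale1r addr0 addrCA subrr addr0.
Qed.

End Segment.

(** A concave quadratic that is positive at [0] and at [1] has one root on each
    side of the interval. *)
Lemma quadratic_factor (R : realType) (A B D : R) :
    0 < D -> 0 < A -> 0 < A - 2 * B - D ->
  exists al be, [/\ 0 < al, 1 < be &
    forall l, A - 2 * l * B - l ^+ 2 * D = D * (l + al) * (be - l)].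
Proof.
move=> D0 A0 Q1; pose r := Num.sqrt (B ^+ 2 + D * A).
have r2 : r ^+ 2 = B ^+ 2 + D * A.
  by rewrite sqr_sqrtr // addr_ge0 ?sqr_ge0 // mulr_ge0 ?ltW.
have r0 : 0 <= r by exact: sqrtr_ge0.
have DA : 0 < D * A by rewrite mulr_gt0.
have DQ : 0 < D * (A - 2 * B - D) by rewrite mulr_gt0.
exists ((B + r) / D), ((r - B) / D); split.
- by rewrite divr_gt0 //; nra.
- by rewrite ltr_pdivlMr // mul1r; nra.
- move=> l; have -> : A = (r ^+ 2 - B ^+ 2) / D by rewrite r2; field; rewrite lt0r_neq0.
  by field; rewrite lt0r_neq0.
Qed.

(** If [x != y], then along the segment [1 - |z|^2] is a quadratic polynomial in the
    parameter with one root on each side of [0, 1], so the density has a logarithmic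
    primitive by partial fractions. *)
Lemma segment_integral (R : realType) n (x y : 'rV[R]_n) :
    unit_ball x -> unit_ball y ->
  exists I, is_line_integral (@hyperbolic_density R n) 0 1 (segment x y) I.
Proof.
move=> x1 y1; set d := enorm (x - y).
have [d0|dn0] := eqVneq d 0.
  exists (0 - 0); apply: (is_line_integral_primitive (H := fun=> 0) (K := 0)) => //.
  move=> u xi w u0 uxi xiw w1.
  by rewrite segment_sub ?(le_trans uxi) // -/d d0 !mul0r mulr0 !subr0 normr0.
have d0 : 0 < d by rewrite lt0r dn0 enorm_ge0.
have Q l : 1 - enorm (segment x y l) ^+ 2
    = (1 - enorm x ^+ 2) - 2 * l * dotp x (y - x) - l ^+ 2 * d ^+ 2.
  have := enorm_comb 1 l x (y - x); rewrite scale1r => ->.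
  by rewrite (enorm_distC y) -/d; ring.
have Qgt0 l : 0 <= l <= 1 -> 0 < 1 - enorm (segment x y l) ^+ 2.
  by move=> /(segment_unit_ball x1 y1); have := enorm_ge0 (segment x y l); nra.
have [|||al [be [al0 be1 F]]] :=
  @quadratic_factor R (1 - enorm x ^+ 2) (dotp x (y - x)) (d ^+ 2).
- by rewrite exprn_gt0.
- by have := Qgt0 0; rewrite Q; rewrite lexx ler01 => /(_ isT); lra.
- by have := Qgt0 1; rewrite Q; rewrite lexx ler01 => /(_ isT); lra.
pose c := 2 / (d * (al + be)).
have ab0 : 0 < al + be by lra.
have c0 : 0 <= c by rewrite divr_ge0 // mulr_ge0 // ltW.
pose H l := c * (ln (l + al) - ln (be - l)).
exists (H 1 - H 0).
apply: (@is_line_integral_primitive _ _ _ _ _ _ H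
  (c * (1 / al ^+ 2 + 1 / (be - 1) ^+ 2))) => // [|u xi w u0 uxi xiw w1].
  by rewrite mulr_ge0 // addr_ge0 // divr_ge0 // sqr_ge0.
have xi1 : 0 <= xi <= 1 by rewrite (le_trans u0 uxi) (le_trans xiw w1).
rewrite segment_sub ?(le_trans uxi) // -/d /hyperbolic_density Q F.
have k1 : 0 < xi + al by lra.
have k2 : 0 < be - xi by lra.
have -> : 2 / (d ^+ 2 * (xi + al) * (be - xi)) * (d * (w - u))
    = c * ((w - u) / (xi + al) + (w - u) / (be - xi)).
  by rewrite /c; field; rewrite !lt0r_neq0.
have -> : c * ((w - u) / (xi + al) + (w - u) / (be - xi)) - (H w - H u)
    = c * (((w - u) / (xi + al) - (ln (w + al) - ln (u + al)))
         + ((w - u) / (be - xi) - (ln (be - u) - ln (be - w)))).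
  by rewrite /H; ring.
rewrite normrM (ger0_norm c0) -[leRHS]mulrA ler_wpM2l // !mul1r [leRHS]mulrDl.
rewrite (mulrC (al ^+ 2)^-1) (mulrC ((be - 1) ^+ 2)^-1).
apply: (le_trans (ler_normD _ _)); apply: lerD.
  have := @ln_sub_approx R al (u + al) (xi + al) (w + al).
  have -> : w + al - (u + al) = w - u by ring.
  by apply; lra.
have := @ln_sub_approx R (be - 1) (be - w) (be - xi) (be - u).
have -> : be - u - (be - w) = w - u by ring.
by apply; lra.
Qed.

Lemma hyperbolic_ge (R : realType) n (x y : 'rV[R]_n) :
    unit_ball x -> unit_ball y ->
  ln (1 + 2 * enorm (x - y) / (1 - enorm x ^+ 2)) <= hyperbolic x y.
Proof.
move=> x1 y1; apply: lb_le_inf => [|I [a [b [g [gC gI]]]]].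
  have [I xyI] := segment_integral x1 y1.
  by exists I, 0, 1, (segment x y); split => //; exact: segment_rectifiable_curve.
exact: hyperbolic_length_ge gC gI.
Qed.

Lemma hyperbolic_le_segment (R : realType) n (x y : 'rV[R]_n) :
    unit_ball x -> unit_ball y ->
  exists2 I, is_line_integral (@hyperbolic_density R n) 0 1 (segment x y) I &
    hyperbolic x y <= I.
Proof.
move=> x1 y1; have [I xyI] := segment_integral x1 y1; exists I => //.
apply: ge_inf; last first.
  by exists 0, 1, (segment x y); split => //; exact: segment_rectifiable_curve.
exists (ln (1 + 2 * enorm (x - y) / (1 - enorm x ^+ 2))) => J [a [b [g [gC gJ]]]].
exact: hyperbolic_length_ge gC gJ.
Qed.

(** The ball of radius [M] is convex, so the density on the segment is at most
    [2 / (1 - M^2)]. *)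
Lemma hyperbolic_le_density (R : realType) n (x y : 'rV[R]_n) (M : R) :
    enorm x <= M -> enorm y <= M -> M < 1 ->
  hyperbolic x y <= 2 * enorm (x - y) / (1 - M ^+ 2).
Proof.
move=> xM yM M1; have x1 := le_lt_trans xM M1; have y1 := le_lt_trans yM M1.
have [I xyI /le_trans] := hyperbolic_le_segment x1 y1; apply.
have := @line_integral_le R n (@hyperbolic_density R n) 0 1 (segment x y) I
  ( *%R (2 * enorm (x - y) / (1 - M ^+ 2))) (fun u _ => u).
rewrite mulr1 mulr0 subr0; apply => // [u w uw|u w u0 uw w1].
  by rewrite lexx.
have zM : enorm (segment x y u) <= M.
  by apply: enorm_segment_le; rewrite // u0 (le_trans (ltW uw)).
have z0 := enorm_ge0 (segment x y u).
rewrite segment_sub ?(ltW uw) // -mulrBr mulrA ler_wpM2r ?subr_ge0 ?(ltW uw) //.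
rewrite [leRHS]mulrAC ler_wpM2r ?enorm_ge0 // ler_wpM2l // lef_pV2 ?posrE; nra.
Qed.

(** By [2 / (1 - |z|^2) = 1 / (1 - |z|) + 1 / (1 + |z|)]: on the segment the first
    term is at most [1 / (1 - M)], and the second at most
    [1 / (1 - |x| + |z - x|)], which integrates to a logarithm. *)
Lemma hyperbolic_le_split (R : realType) n (x y : 'rV[R]_n) (M : R) :
    enorm x <= M -> enorm y <= M -> M < 1 ->
  hyperbolic x y <=
    enorm (x - y) / (1 - M) + ln (1 + enorm (x - y) / (1 - enorm x)).
Proof.
move=> xM yM M1; have x1 := le_lt_trans xM M1; have y1 := le_lt_trans yM M1.
have [I xyI /le_trans] := hyperbolic_le_segment x1 y1; apply.
set d := enorm (x - y); have d0 : 0 <= d by exact: enorm_ge0.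
have m1 : 0 < 1 - enorm x by rewrite subr_gt0.
have q (l : R) : 0 <= l -> 0 < 1 - enorm x + d * l.
  by move=> l0; rewrite ltr_wpDr // mulr_ge0.
pose G l := d / (1 - M) * l + ln (1 - enorm x + d * l).
have -> : d / (1 - M) + ln (1 + d / (1 - enorm x)) = G 1 - G 0.
  have md0 : 0 < 1 - enorm x + d by lra.
  rewrite /G !mulr1 !mulr0 addr0 add0r -[RHS]addrA -ln_div ?posrE //.
  by congr (_ + ln _); field; rewrite lt0r_neq0.
(* right tags make each term at most an increment of the concave logarithm *)
apply: (line_integral_le (tag := fun _ w => w) _ _ _ xyI) => // [u w uw|u w u0 uw w1].
  by rewrite lexx andbT.
have w0 : 0 <= w by rewrite (le_trans u0 (ltW uw)).
set z := segment x y w.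
have zM : enorm z <= M by apply: enorm_segment_le; rewrite // w0.
have zx : d * w - enorm x <= enorm z.
  have := enorm_dist_triangle 0 z x; rewrite subr0 sub0r enormN.
  have := segment_sub x y w0; rewrite {2}/segment scale0r addr0 -/z subr0 => ->.
  by rewrite -/d; lra.
have z0 := enorm_ge0 z.
rewrite segment_sub ?(ltW uw) // -/d.
have lnp := ln_sub_le (q w w0) (q u u0).
have -> : G w - G u = d / (1 - M) * (w - u) -
    (ln (1 - enorm x + d * u) - ln (1 - enorm x + d * w)).
  by rewrite /G; ring.
have -> : hyperbolic_density z = 1 / (1 - enorm z) + 1 / (1 + enorm z).
  by rewrite /hyperbolic_density; field; apply/andP; split; nra.
rewrite mulrDl; apply: lerD.
  rewrite [d / _]mulrC -[_ * d * _]mulrA ler_wpM2r ?mulr_ge0 // ?subr_ge0 ?(ltW uw) //.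
  by rewrite mul1r lef_pV2 ?posrE; lra.
apply: (@le_trans _ _ (1 / (1 - enorm x + d * w) * (d * (w - u)))).
  rewrite ler_wpM2r ?mulr_ge0 ?subr_ge0 ?(ltW uw) // !mul1r lef_pV2 ?posrE ?q //; lra.
rewrite lerNr; apply: (le_trans lnp); rewrite mul1r mulrC -mulrN.
by rewrite ler_wpM2l ?invr_ge0 ?(ltW (q _ _)) //; lra.
Qed.

(** * Bounds for the Cassinian metric *)

Section Cassinian.
Context {R : realType} {n : nat}.
Implicit Types (x y p : 'rV[R]_n).

Lemma cassinian_term_le x y p (u v : R) : 0 < u -> 0 < v ->
    u <= enorm (x - p) -> v <= enorm (p - y) ->
  enorm (x - y) / (enorm (x - p) * enorm (p - y)) <= enorm (x - y) / (u * v).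
Proof.
move=> u0 v0 up vp; rewrite ler_wpM2l ?enorm_ge0 // lef_pV2 ?posrE ?mulr_gt0 //.
- by rewrite ler_pM // ltW.
- exact: lt_le_trans up.
- exact: lt_le_trans vp.
Qed.

Lemma boundary_dist_ge x p : boundary unit_ball p -> 1 - enorm x <= enorm (x - p).
Proof.
move=> /boundary_unit_ball_ge p1; rewrite enorm_distC.
by apply: le_trans (enorm_sub_ge p x); rewrite lerB.
Qed.

Lemma cassinian_ge x y p : unit_ball x -> unit_ball y -> enorm p = 1 ->
  enorm (x - y) / (enorm (x - p) * enorm (p - y)) <= cassinian unit_ball x y.
Proof.
move=> x1 y1 p1; apply: ub_le_sup; last first.
  by exists p => //; exact: boundary_unit_ball_sphere.
exists (enorm (x - y) / ((1 - enorm x) * (1 - enorm y))) => _ [r rb <-].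
apply: cassinian_term_le; rewrite ?subr_gt0 ?boundary_dist_ge //.
by rewrite enorm_distC boundary_dist_ge.
Qed.

Lemma cassinianC (D : set 'rV[R]_n) x y : cassinian D x y = cassinian D y x.
Proof.
congr sup; apply: eq_imagel => p _.
by rewrite enorm_distC (enorm_distC x p) (enorm_distC p y) [_ * enorm (y - p)]mulrC.
Qed.

End Cassinian.

Lemma cassinian_le (R : realType) n (x y : 'rV[R]_n) : (0 < n)%N ->
    unit_ball x -> enorm (x - y) < 1 - enorm x ->
  cassinian unit_ball x y <=
    enorm (x - y) / ((1 - enorm x) * (1 - enorm x - enorm (x - y))).
Proof.
move=> n0 x1 xy; apply: ge_sup.
  have [p p1 _] := nearest_boundary_point n0 x1.
  exists (enorm (x - y) / (enorm (x - p) * enorm (p - y))), p => //.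
  exact: boundary_unit_ball_sphere.
move=> _ [p pb <-]; have xp := boundary_dist_ge x pb.
apply: cassinian_term_le; rewrite ?subr_gt0 //.
by have := enorm_dist_triangle y x p; rewrite (enorm_distC y p); lra.
Qed.

(** The nearest boundary point [p] to [x] is a test point in the supremum, with
    [|x - p| = 1 - |x|] and [|p - y| <= 1 - |x| + |x - y|]. *)
Lemma cassinian_ge_nearest (R : realType) n (x y : 'rV[R]_n) : (0 < n)%N ->
    unit_ball x -> unit_ball y ->
  enorm (x - y) / ((1 - enorm x) * (1 - enorm x + enorm (x - y)))
    <= cassinian unit_ball x y.
Proof.
move=> n0 x1 y1; have [p p1 xp] := nearest_boundary_point n0 x1.
apply: le_trans (cassinian_ge x1 y1 p1); rewrite xp.
have py0 : 0 < enorm (p - y).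
  by apply: lt_le_trans (enorm_sub_ge p y); rewrite p1 subr_gt0.
have x0 : 0 < 1 - enorm x by rewrite subr_gt0.
have d0 := enorm_ge0 (x - y).
rewrite ler_wpM2l // lef_pV2 ?posrE ?mulr_gt0 //; last by rewrite ltr_wpDr.
rewrite ler_pM2l // -xp (enorm_distC x p).
exact: enorm_dist_triangle.
Qed.

(** Solves the test-point inequality for [d]. With [v = 1 - |x|] and [u] either
    [1 - |x|] or, when [|x| <= |y|], [1 - |y|], both test points give the same
    factor [t v / (1 - t v)]. *)
Lemma cassinian_lt_dist (R : realFieldType) (d t u v : R) :
    0 <= d -> 0 < t -> 0 < u -> u <= v -> t * v < 1 ->
    d / (u * (u + d)) < t ->
  d < t * v / (1 - t * v) * u.
Proof.
move=> d0 t0 u0 uv tv1; have ud : 0 < u + d by rewrite ltr_wpDr.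
rewrite ltr_pdivrMr ?mulr_gt0 // => dt.
have tv : 0 < 1 - t * v by rewrite subr_gt0.
rewrite mulrAC ltr_pdivlMr //.
have : t * u * (u + d) <= t * v * (u + d) by rewrite ler_pM2r // ler_pM2l.
lra.
Qed.

(** * Exponential estimates of the radii *)

Section Arsinh.
Context {R : realType}.
Implicit Types k a u v : R.

Lemma lt_sinh u v : u < v -> sinh u < sinh v.
Proof.
move=> uv; rewrite /sinh ltr_pM2r // ltrD ?ltrN2 ?ltr_expR //.
by rewrite ltrN2.
Qed.

(** [k sinh a <= k (e^a - 1) <= e^(k a) - 1]; the second step is Bernoulli. *)
Lemma sinh_le_expR k a : 1 <= k -> 0 <= a -> k * sinh a <= expR (k * a) - 1.
Proof.
move=> k1 a0; have E : expR a * expR (- a) = 1 by rewrite -expRD subrr expR0.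
have p := expR_gt0 a; have Na := expR_ge1Dx (- a); have ea := expR_ge1Dx a.
have s : sinh a <= expR a - 1 by rewrite /sinh ler_pdivrMr //; nra.
have -> : k * a = a + (k - 1) * a by ring.
rewrite expRD; have := expR_ge1Dx ((k - 1) * a).
have : expR a - 1 <= expR a * a by nra.
nra.
Qed.

(** [sinh_le_expR] at [a = q / k], read through the inverse of [sinh]. *)
Lemma le_arsinh k q : 1 <= k -> 0 <= q -> q / k <= arsinh ((expR q - 1) / k).
Proof.
move=> k1 q0; have k0 : 0 < k by exact: lt_le_trans k1.
rewrite leNgt; apply/negP => /lt_sinh; rewrite arsinhK; apply/negP; rewrite -leNgt.
rewrite ler_pdivlMr // mulrC.
have := sinh_le_expR k1 (divr_ge0 q0 (ltW k0)).
by rewrite [k * (q / k)]mulrC divfK ?lt0r_neq0.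
Qed.

End Arsinh.

(** After exponentiation and multiplication by [1 - m] the claim is
    [1 + m <= e^q (1 + m - d)]. Since [e^q >= 1 + q >= 1 + d / (1 - M)] it
    follows from [(1 - M + d) (1 + m - d) - (1 + m) (1 - M) = d (m + M - d)]. *)
Lemma expR_split_le (R : realType) (m M d q : R) :
    0 <= m -> m <= M -> M < 1 -> 0 <= d -> d <= m + M -> d <= q * (1 - M) ->
  q + ln (1 + d / (1 - m)) <= ln (1 + 2 * (expR q - 1) / (1 - m)).
Proof.
move=> m0 mM M1 d0 dmM dq; have m1 : 0 < 1 - m by lra.
have q0 : 0 <= q by rewrite -(pmulr_lge0 _ (_ : 0 < 1 - M)); lra.
have E := expR_ge1Dx q; have E0 := expR_gt0 q.
have dm : 0 <= d / (1 - m) by rewrite divr_ge0 // ltW.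
rewrite -{1}[q]expRK -lnM ?posrE //; last by lra.
have key : 1 + m <= expR q * (1 + m - d).
  apply: (@le_trans _ _ ((1 + q) * (1 + m - d))); last by rewrite ler_wpM2r //; lra.
  rewrite -(@ler_pM2r _ (1 - M)); last by lra.
  nra.
have Eq0 : 0 <= 2 * (expR q - 1) / (1 - m) by rewrite divr_ge0 ?mulr_ge0 //; lra.
rewrite ler_ln ?posrE ?mulr_gt0 //; [|lra|lra].
have -> : 1 + d / (1 - m) = (1 - m + d) / (1 - m) by field; rewrite lt0r_neq0.
have -> : 1 + 2 * (expR q - 1) / (1 - m) = (1 - m + 2 * (expR q - 1)) / (1 - m).
  by field; rewrite lt0r_neq0.
by rewrite mulrA ler_pM2r ?invr_gt0 //; lra.
Qed.

(** * Inclusions of balls *)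

(* If t (1 - |x|) >= 1 then R is undefined (a zero denominator) or negative, so
   the second inclusion is stated for t (1 - |x|) < 1. *)
Theorem theorem5p8 (R : realType) (n : nat) (hn : (2 <= n)%N)
  (x : 'rV[R]_n) (hx : unit_ball x) (t : R) (ht : 0 < t) :
  let r := ln (1 + 2 * t * (1 - enorm x) /
                   ((1 + enorm x) * (1 + t * (1 - enorm x)))) in
  let E := expR (t * (1 - enorm x) / (1 - t * (1 - enorm x))) in
  let R1 := 2 * arsinh ((E - 1) / (1 + enorm x)) in
  let R2 := ln (1 + 2 * (E - 1) / (1 - enorm x)) in
  hyperbolic_ball x r `<=` cassinian_ball x t /\
  (t * (1 - enorm x) < 1 ->
   cassinian_ball x t `<=` hyperbolic_ball x (Num.min R1 R2)).
Proof.
have n0 : (0 < n)%N by exact: leq_trans hn.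
have m0 := enorm_ge0 x; have m1 : 0 < 1 - enorm x by rewrite subr_gt0.
have tm : 0 < t * (1 - enorm x) by rewrite mulr_gt0.
move=> r E R1 R2; split=> [y [y1 yr]|tm1 y [y1 yt]]; split=> //.
  have d0 := enorm_ge0 (x - y).
  have den : 0 < 1 - enorm x ^+ 2 by nra.
  have := le_lt_trans (hyperbolic_ge hx y1) yr.
  have pos : 0 < (1 + enorm x) * (1 + t * (1 - enorm x)) by rewrite mulr_gt0 //; lra.
  rewrite ltr_ln ?posrE; first last.
  - by rewrite ltr_wpDr // divr_ge0 ?(ltW pos) // -mulrA mulr_ge0 // ltW.
  - by rewrite ltr_wpDr // divr_ge0 ?(ltW den) // mulr_ge0.
  rewrite ltrD2l ltr_pdivrMr // mulrAC ltr_pdivlMr //.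
  set d := enorm (x - y) in d0 *; move=> dr.
  (* [dr] is this inequality multiplied by [2 (1 + m)] *)
  have dt : d * (1 + t * (1 - enorm x)) < t * (1 - enorm x) ^+ 2.
    rewrite -(@ltr_pM2l _ (2 * (1 + enorm x))) ?mulr_gt0 //; last by lra.
    by move: dr; congr (_ < _); ring.
  (* since [t (1 - m) d <= d (1 + t (1 - m))] *)
  have d1 : d < 1 - enorm x.
    rewrite -(@ltr_pM2l _ (t * (1 - enorm x))) //; nra.
  apply: (le_lt_trans (cassinian_le n0 hx d1)); rewrite -/d.
  by rewrite ltr_pdivrMr ?mulr_gt0 ?subr_gt0 //; nra.
have d0 := enorm_ge0 (x - y); have s0 := enorm_ge0 y.
rewrite /R1 /R2 /E; set q := t * (1 - enorm x) / (1 - t * (1 - enorm x)).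
have q0 : 0 < q by rewrite divr_gt0 // subr_gt0.
have dx : enorm (x - y) < q * (1 - enorm x).
  apply: cassinian_lt_dist => //.
  exact: le_lt_trans (cassinian_ge_nearest n0 hx y1) yt.
have dy : enorm x <= enorm y -> enorm (x - y) < q * (1 - enorm y).
  move=> xy; apply: cassinian_lt_dist; rewrite ?subr_gt0 ?lerB //.
  rewrite enorm_distC; apply: le_lt_trans (cassinian_ge_nearest n0 y1 hx) _.
  by rewrite cassinianC.
(* [M] is the larger of the two norms; [dy] is available only if it is [|y|] *)
have [M [xM yM M1 dM MxM]] : exists M : R, [/\ enorm x <= M, enorm y <= M, M < 1,
    enorm (x - y) < q * (1 - M) & enorm (x - y) <= enorm x + M].
  have d_le : enorm (x - y) <= enorm x + enorm y by rewrite -(enormN y) enormD.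
  have [xy|yx] := leP (enorm x) (enorm y).
    by exists (enorm y); split => //; exact: dy.
  by exists (enorm x); split; rewrite ?(ltW yx) //; lra.
have M2 : 0 < 1 - M ^+ 2 by nra.
rewrite lt_min; apply/andP; split.
  apply: (le_lt_trans (hyperbolic_le_density xM yM M1)).
  apply: (@lt_le_trans _ _ (2 * (q / (1 + enorm x)))); last first.
    by rewrite ler_pM2l // le_arsinh ?lerDl // ltW.
  rewrite -mulrA ltr_pM2l // ltr_pdivrMr // mulrAC ltr_pdivlMr; last by lra.
  nra.
apply: (le_lt_trans (hyperbolic_le_split xM yM M1)).
apply: (@lt_le_trans _ _ (q + ln (1 + enorm (x - y) / (1 - enorm x)))).
  by rewrite ltrD2r ltr_pdivrMr // subr_gt0.
by apply: (expR_split_le (M := M)) => //; exact: ltW.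
Qed.
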